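(* Let $G$ be any group with any collection $\{\sigma_j \mid j\in J\}$ of pairwise non-isomorphic splittings. For each $j\in J$, let $X_j$ be an $H_j$-almost invariant set arising from $\sigma_j$. Let $\Sigma:=\bigcup_{j\in J}\Sigma(X_j)$. Define a binary relation $\leq$ on $\Sigma$ by $$A\leq B \iff A\cap B^* \text{ is empty or is the only small corner of the pair } (A,B).$$ Here ''small'' means ''$\mathrm{Stab}(A)$-finite'', or equivalently ''$\mathrm{Stab}(B)$-finite''. Then $\leq$ is a partial order on $\Sigma$.
   Context: For $X\subset G$, $X^*=G\setminus X$, $\Sigma(X)=\{gX,gX^*\mid g\in G\}$, and $\mathrm{Stab}(X)=\{g\in G: gX=X\}$. A subset of $G$ is $H$-finite if it is contained in finitely many right cosets $Hg_i$. The corners of a pair $(A,B)$ are $A\cap B$, $A\cap B^*$, $A^*\cap B$, $A^*\cap B^*$. A $G$-tree is a simplicial tree with a simplicial $G$-action that inverts no edge. A splitting of $G$ is a $G$-tree $T$ with no global fixed point such that $G\backslash T$ has exactly one edge. Two splittings are isomorphic if there is a $G$-equivariant isomorphism between their trees. An $H$-almost invariant set arising from the splitting is a set $X=\{g\in G : e \text{ points away from } gv\}$, where $v$ is a vertex of $T$, $e$ is a directed edge of $T$, and $H=\mathrm{Stab}(e)=\mathrm{Stab}(X)$; ''$e$ points away from $gv$'' means that $gv$ lies in the component of $T$ minus the interior of $e$ containing the initial vertex of $e$. *)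

(* Defs.v *)
From mathcomp Require Import all_boot monoid.
From mathcomp Require Import boolp classical_sets cardinality.
From Corelib Require Export Relation_Definitions.

Set Implicit Arguments.
Unset Strict Implicit.
Unset Printing Implicit Defensive.

Local Open Scope classical_set_scope.
Local Open Scope group_scope.

(* A simplicial tree is given by its vertex type and its adjacency relation:
   being a one-dimensional simplicial complex, it has neither loops nor multiple
   edges. An edge is a pair of adjacent vertices; the pair [(x, y)] is that edge
   directed from [x] to [y]. *)

Definition joined (V : eqType) (e : rel V) (x y : V) : Prop :=
  exists2 p : seq V, path e x p & last x p = y.

(* Closed walks of length at most 2 without repeated vertices are not circuits:
   [:: x; y] is an [e]-cycle as soon as [x] and [y] are adjacent. *)
Definition acyclic (V : eqType) (e : rel V) : Prop :=
  forall c : seq V, ucycle e c -> size c <= 2.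

Record is_tree (V : eqType) (e : rel V) : Prop := IsTree {
  tree_sym : ssrbool.symmetric e;
  tree_irrefl : irreflexive e;
  tree_inhabited : inhabited V;
  tree_connected : forall x y, joined e x y;
  tree_acyclic : acyclic e
}.

Record gtree (G : groupType) := GTree {
  vertex : eqType;
  adj : rel vertex;
  act : G -> vertex -> vertex;
  gtree_is_tree : is_tree adj;
  gtree_act1 : forall x, act 1 x = x;
  gtree_actM : forall g h x, act (g * h) x = act g (act h x);
  gtree_act_adj : forall g x y, adj (act g x) (act g y) = adj x y;
  gtree_no_inversion :
    forall g x y, adj x y -> ~ (act g x = y /\ act g y = x)
}.

Arguments adj {G} T : rename.
Arguments act {G} T : rename.

(* As no edge is inverted, a point fixed by [G] in the interior of an edge would
   have its two endpoints fixed as well, so it is enough to look at vertices. *)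
Definition has_global_fixed_point (G : groupType) (T : gtree G) : Prop :=
  exists x : vertex T, forall g, act T g x = x.

(* The (undirected) edges form exactly one [G]-orbit. *)
Definition one_edge_quotient (G : groupType) (T : gtree G) : Prop :=
  exists x y : vertex T, adj T x y /\
    forall x' y', adj T x' y' ->
      exists g, (act T g x = x' /\ act T g y = y') \/
                (act T g x = y' /\ act T g y = x').

Record splitting (G : groupType) := Splitting {
  splitting_tree :> gtree G;
  splitting_no_fixed_point : ~ has_global_fixed_point splitting_tree;
  splitting_one_edge : one_edge_quotient splitting_tree
}.

Definition splitting_iso (G : groupType) (S T : splitting G) : Prop :=
  exists f : vertex S -> vertex T,
    [/\ bijective f,
        forall x y, adj T (f x) (f y) = adj S x y &
        forall g x, f (act S g x) = act T g (f x)].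

(* What remains of the tree once the interior of the edge [{x, y}] is removed. *)
Definition remove_edge (V : eqType) (e : rel V) (x y : V) : rel V :=
  fun a b => [&& e a b, (a, b) != (x, y) & (a, b) != (y, x)].

(* The directed edge from [x] to [y] points away from the vertex [w]. *)
Definition points_away (G : groupType) (T : gtree G) (x y w : vertex T) : Prop :=
  joined (remove_edge (adj T) x y) x w.

Definition edge_stab (G : groupType) (T : gtree G) (x y : vertex T) : set G :=
  [set g | act T g x = x /\ act T g y = y].

Definition arises_from (G : groupType) (S : splitting G) (H X : set G) : Prop :=
  exists v x y : vertex S,
    [/\ adj S x y, H = edge_stab x y &
        X = [set g | points_away x y (act S g v)]].

Definition ltranslate (G : groupType) (g : G) (X : set G) : set G :=
  [set g * x | x in X].

Definition Sigma_of (G : groupType) (X : set G) : set (set G) :=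
  [set A | exists g, A = ltranslate g X \/ A = ltranslate g (~` X)].

Definition Stab (G : groupType) (X : set G) : set G :=
  [set g | ltranslate g X = X].

Definition H_finite (G : groupType) (H X : set G) : Prop :=
  exists2 F : set G, finite_set F & X `<=` \bigcup_(k in F) [set h * k | h in H].

Definition corners (G : groupType) (A B : set G) : set (set G) :=
  [set C | [\/ C = A `&` B, C = A `&` ~` B, C = ~` A `&` B | C = ~` A `&` ~` B]].

Definition small_corner (G : groupType) (A B C : set G) : Prop :=
  corners A B C /\ H_finite (Stab A) C.

(* The corners of a pair are disjoint, hence a nonempty corner differs, as a
   set, from the three other ones; the second disjunct matters only then. *)
Definition ai_le (G : groupType) (A B : set G) : Prop :=
  A `&` ~` B = set0 \/
  (small_corner A B (A `&` ~` B) /\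
   forall C, small_corner A B C -> C = A `&` ~` B).

(* Main.v *)
(* If finitely many cosets [Hk] cover [D `<=` B] and a whole coset [Hl] misses
   [B], then right multiplication by [k^-1 * l] takes the points of [D] in [Hk]
   out of [B], so almost invariance of [B] makes [D] finite modulo [Stab B]. This
   yields both the symmetry of smallness and the transitivity of almost inclusion
   (smallness of [A `&` ~` B]). If [A <= B <= C] and the corner opposite to
   [A `&` ~` C] is small too, then [A], [B] and [C] are almost equal, so [A <= B]
   and [B <= C] must be genuine inclusions. Adjacent corners are not both small
   because neither half of a splitting is small: the tree has no leaf, so every
   half-tree contains points of the orbit arbitrarily deep in it. *)
Require Import Defs.
From mathcomp Require Import all_boot monoid.
From mathcomp Require Import boolp classical_sets cardinality.

Local Open Scope classical_set_scope.

(** * Walks and reachability in a graph *)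

Section Walks.
Variables (V : eqType) (r : rel V).

Lemma joined_refl x : joined r x x.
Proof. by exists [::]. Qed.

Lemma joined_rcons x y z : joined r x y -> r y z -> joined r x z.
Proof.
move=> [p xp <-] yz; exists (rcons p z); last by rewrite last_rcons.
by rewrite rcons_path xp.
Qed.

(** Induction on the far end of the walk: a property of the start propagates along edges leaving
    vertices already reached. *)
Lemma joined_ind (P : V -> Prop) x :
  P x -> (forall y z, joined r x y -> P y -> r y z -> P z) ->
  forall y, joined r x y -> P y.
Proof.
move=> Px step y [p]; elim/last_ind: p y => [|p z IHp] y /=.
  by move=> _ <-.
rewrite rcons_path last_rcons => /andP[xp pz] <-.
by apply: (step (last x p)) => //; [exists p | exact: IHp].
Qed.

Lemma joined_trans x y z : joined r x y -> joined r y z -> joined r x z.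
Proof.
move=> xy; apply: (joined_ind (joined r x)) => // u w _.
exact: joined_rcons.
Qed.

Lemma joined_sym x y :
  ssrbool.symmetric r -> joined r x y -> joined r y x.
Proof.
move=> rC; apply: (joined_ind (joined r ^~ x) x) => [|u w _ ux uw].
  exact: joined_refl.
by apply: joined_trans ux; apply: joined_rcons (joined_refl _) _; rewrite rC.
Qed.

End Walks.

(** * Half-trees cut off by an edge *)

Section HalfTrees.
Variables (V : eqType) (e : rel V).
Hypothesis e_tree : is_tree e.

(** The side of [a] after cutting the edge [{a, b}]; for a [G]-tree this is [points_away a b]. *)
Let half a b := joined (remove_edge e a b) a.

Let eC : ssrbool.symmetric e := tree_sym e_tree.

Lemma remove_edgeC a b : remove_edge e a b =2 remove_edge e b a.
Proof. by move=> u w; rewrite /remove_edge; congr andb; rewrite andbC. Qed.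

Lemma remove_edge_sym a b : ssrbool.symmetric (remove_edge e a b).
Proof.
move=> u w; rewrite /remove_edge eC !xpair_eqE; congr andb.
by rewrite andbC (andbC (u == b)) (andbC (u == a)).
Qed.

Lemma adj_neq a b : e a b -> a != b.
Proof. by apply: contraTneq => ->; rewrite (tree_irrefl e_tree). Qed.

(** A walk from [a] to [b] avoiding the edge, once shortened to a simple one, closes up with that
    edge to a circuit. Acyclicity leaves only the empty walk and the removed edge itself. *)
Lemma half_bridge a b : e a b -> ~ half a b b.
Proof.
move=> ab [p0 ap0 lastp0]; move: lastp0.
case/shortenP: ap0 => p ap up _ lastp.
have lastab : e (last a p) a by rewrite lastp eC.
have/(tree_acyclic e_tree) : ucycle e (a :: p).
  rewrite /ucycle up andbT /= rcons_path lastab andbT.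
  by apply: sub_path ap => u w /and3P[].
case: p ap lastp {up lastab} => [|c [|//]] /=.
  by move=> _ aEb; move: (adj_neq _ _ ab); rewrite aEb eqxx.
by move=> + cEb _; rewrite cEb /remove_edge eqxx andbF.
Qed.

Lemma half_step a b u w :
  e u w -> half a b u -> half a b w \/ (u = a /\ w = b).
Proof.
move=> uw au; have [[-> ->]|nab] := eqVneq (u, w) (a, b); first by right.
have [[_ ->]|nba] := eqVneq (u, w) (b, a); first by left; exact: joined_refl.
by left; apply: joined_rcons au _; rewrite /remove_edge uw nab nba.
Qed.

Lemma half_cover a b w : half a b w \/ half b a w.
Proof.
pose covered u := half a b u \/ half b a u.
apply: (joined_ind _ _ covered a) (tree_connected e_tree a w).
  by left; exact: joined_refl.
move=> u z _ + uz => -[] /(half_step _ _ _ _ uz) [?|[_ ->]].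
- by left.
- by right; exact: joined_refl.
- by right.
- by left; exact: joined_refl.
Qed.

Lemma half_disjoint a b w : e a b -> half a b w -> ~ half b a w.
Proof.
move=> ab aw bw; apply: (half_bridge a b ab); apply: joined_trans aw _.
apply: joined_sym; first exact: remove_edge_sym.
by case: bw => p bp <-; exists p => //; rewrite (eq_path (remove_edgeC a b)).
Qed.

Lemma halfC a b w : e a b -> ~ half a b w <-> half b a w.
Proof.
move=> ab; split=> [naw|bw aw]; first by case: (half_cover a b w).
exact: half_disjoint bw.
Qed.

(** Starting from [c], the half-tree [half a b] could be left only through [a], which is unreachable
    from [c] because [{c, a}] is a bridge. *)
Lemma half_nested a b c w :
  e a b -> e a c -> c != b -> half c a w -> half a b w.
Proof.
move=> ab ac cb; have ca : e c a by rewrite eC.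
apply: (joined_ind _ _ (half a b) c) => [|u z cu au uz].
  have [//|[_ cEb]] := half_step a b a c ac (joined_refl _ _ _).
  by rewrite cEb eqxx in cb.
have [|//|[ua _]] := half_step a b u z _ au; first by case/and3P: uz.
by case: (half_bridge c a ca); rewrite -{2}ua.
Qed.

(** The walk can leave only by crossing from [a] to [b]; [q] is what follows such a crossing, so at
    least one step is lost. *)
Lemma half_exit a b u p :
  e a b -> half a b u -> path e u p -> ~ half a b (last u p) ->
  exists2 q, path e b q /\ last b q = last u p & size q < size p.
Proof.
move=> ab; elim: p u => [//|c p IHp] u au /= /andP[uc cp] out.
have [ac|[_ cEb]] := half_step a b u c uc au.
  by have [q q1 q2] := IHp c ac cp out; exists q => //; exact: leqW.
by exists p => //; rewrite -cEb.
Qed.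

(** Each induction step prolongs the edge at [a] to a neighbour [c] other than [b]. By [half_exit],
    a walk out of the smaller half-tree [half c a] costs one more step before it continues from
    [a]. *)
Lemma half_deep x y n :
  (forall a b, e a b -> exists2 c, e a c & c != b) -> e x y ->
  exists a b, [/\ e a b, forall w, half a b w -> half x y w &
    forall w p, half a b w -> path e w p -> ~ half x y (last w p) ->
      n <= size p].
Proof.
move=> noleaf xy; elim: n => [|n [a [b [ab abxy deep]]]]; first by exists x, y.
have [c ac cb] := noleaf a b ab; have ca : e c a by rewrite eC.
have caab w : half c a w -> half a b w by exact: half_nested.
exists c, a; split=> // [w /caab/abxy //|w p cw wp out].
have [|q [aq qE] ltqp] := half_exit c a w p ca cw wp.
  by move=> /caab/abxy.
apply: leq_trans ltqp; apply: (deep a) => //; first exact: joined_refl.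
by rewrite qE.
Qed.

Lemma exists_neighbour u x y : e x y -> exists w, e u w.
Proof.
move=> xy; have {xy y} [w uw] : exists w, w != u.
  have [xu|] := eqVneq x u; last by exists x.
  by exists y; rewrite eq_sym -xu (adj_neq _ _ xy).
have [[|z p] /= up lastp] := tree_connected e_tree u w.
  by rewrite lastp eqxx in uw.
by exists z; case/andP: up.
Qed.

End HalfTrees.

(** * Group actions on trees with a single orbit of edges *)

Section Actions.
Variables (G : groupType) (T : gtree G).
Implicit Types (g h : G) (x y u v w a b c : vertex T).

Let adjC x y : adj T x y = adj T y x := tree_sym (gtree_is_tree T) x y.

Lemma actK g : cancel (act T g) (act T g^-1).
Proof. by move=> x; rewrite -gtree_actM mulVg gtree_act1. Qed.

Lemma actVK g : cancel (act T g^-1) (act T g).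
Proof. by move=> x; rewrite -gtree_actM mulgV gtree_act1. Qed.

Lemma path_act g u p :
  path (adj T) (act T g u) (map (act T g) p) = path (adj T) u p.
Proof.
by rewrite path_map; apply: eq_path => a b; rewrite /= gtree_act_adj.
Qed.

Lemma points_awayC x y w :
  adj T x y -> ~ points_away x y w <-> points_away y x w.
Proof. exact: halfC (gtree_is_tree T) x y w. Qed.

(* If [u] had [w] as its only neighbour, all edges would be translates of
   [(u, w)], hence would contain a leaf, and the tree would be a star. *)
Lemma no_leaf : one_edge_quotient T -> ~ has_global_fixed_point T ->
  forall u w, adj T u w -> exists2 z, adj T u z & z != w.
Proof.
move=> [x [y [xy orb]]] nofix u w uw; apply: contrapT => leaf.
have uleaf z : adj T u z -> z = w.
  move=> uz; apply: contrapT => /eqP zw; apply: leaf; by exists z.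
have guleaf g z : adj T (act T g u) z -> z = act T g w.
  by rewrite -{1}(actVK g z) gtree_act_adj => /uleaf E; rewrite -E actVK.
(* If [g] maps [u] to [w], then [w] is a leaf too and its only neighbour, the image of [w], must be
   [u]: [g] inverts the edge. *)
have wu g : act T g u <> w.
  move=> guw; have := guleaf g u; rewrite guw adjC => /(_ uw) ugw.
  by apply: (@gtree_no_inversion _ T g u w).
have orbu a b : adj T a b ->
    exists g, (act T g u = a /\ act T g w = b) \/
              (act T g u = b /\ act T g w = a).
  move=> ab; have [g gab] := orb a b ab; have [h huw] := orb u w uw.
  exists (g * h^-1)%g; rewrite !gtree_actM.
  case: huw => -[<- <-]; rewrite !actK; case: gab => -[<- <-]; tauto.
have nbrw z : adj T w z -> exists g, z = act T g u /\ act T g w = w.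
  move=> /orbu [g [[/wu //]|[<- ?]]]; by exists g.
pose in_star z := z = w \/ exists g, z = act T g u /\ act T g w = w.
have star z : in_star z.
  apply: (joined_ind _ _ in_star w) (tree_connected (gtree_is_tree T) w z).
    by left.
  move=> a b _ [-> /nbrw|[g [-> gw]] /guleaf]; first by right.
  by rewrite gw; left.
apply: nofix; exists w => g; have [//|[h [gwh hw]]] := star (act T g w).
by case: (wu (g^-1 * h)%g); rewrite gtree_actM -gwh actK.
Qed.

(** The vertex [v] lies on some edge, and that edge is a translate of [{a, b}]. *)
Lemma adj_meets_orbit v a b : one_edge_quotient T -> adj T a b ->
  exists g, act T g v = a \/ act T g v = b.
Proof.
move=> [x [y [xy orb]]] ab.
have [w vw] := exists_neighbour _ _ (gtree_is_tree T) v _ _ xy.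
have [g gab] := orb a b ab; have [h hvw] := orb v w vw.
exists (g * h^-1)%g; rewrite gtree_actM.
by case: hvw => [[<- _]|[_ <-]]; rewrite actK; case: gab => -[<- <-]; tauto.
Qed.

End Actions.

(** * Translates, stabilisers, almost invariant sets and their order *)

Section AlmostInvariantSets.
Variable G : groupType.
Local Open Scope group_scope.
Implicit Types (g h k l : G) (A B C D X Y H : set G).

Lemma ltranslateE g X a : ltranslate g X a <-> X (g^-1 * a).
Proof.
split=> [[x Xx <-]|Xa]; first by rewrite mulKg.
by exists (g^-1 * a) => //; rewrite mulVKg.
Qed.

Lemma ltranslateM g h X :
  ltranslate g (ltranslate h X) = ltranslate (g * h) X.
Proof.
by apply/seteqP; split=> a; rewrite !ltranslateE invgM mulgA.
Qed.

Lemma ltranslate1 X : ltranslate 1 X = X.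
Proof. by apply/seteqP; split=> a; rewrite ltranslateE invg1 mul1g. Qed.

Lemma ltranslateC g X : ltranslate g (~` X) = ~` ltranslate g X.
Proof.
apply/seteqP; split=> a; rewrite ltranslateE /setC /= -/(ltranslate g X a);
  by rewrite ltranslateE.
Qed.

Lemma StabM A g h : Stab A g -> Stab A h -> Stab A (g * h).
Proof. by rewrite /Stab /= -ltranslateM => gA ->. Qed.

Lemma StabV A g : Stab A g -> Stab A g^-1.
Proof. by rewrite /Stab /= => {1}<-; rewrite ltranslateM mulVg ltranslate1. Qed.

Lemma Stab_setC A : Stab (~` A) = Stab A.
Proof.
apply/seteqP; split=> g; rewrite /Stab /= ltranslateC; last by move->.
by move=> /(congr1 setC); rewrite !setCK.
Qed.

Lemma Stab_mem A h a : Stab A h -> A (h * a) <-> A a.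
Proof.
move=> hA; have {1}-> : A = ltranslate h A by rewrite hA.
by rewrite ltranslateE mulKg.
Qed.

Lemma Stab_ltranslate A g h :
  Stab A h -> Stab (ltranslate g A) (g * h * g^-1).
Proof.
by rewrite /Stab /= => hA; rewrite ltranslateM mulgVK -ltranslateM hA.
Qed.

Lemma H_finite_sub H X Y : X `<=` Y -> H_finite H Y -> H_finite H X.
Proof. by move=> XY [F finF YF]; exists F => //; apply: subset_trans YF. Qed.

Lemma H_finite0 H : H_finite H set0.
Proof. by exists set0; [exact: finite_set0 | exact: sub0set]. Qed.

Lemma H_finite_bigcup H (F : set G) (D : G -> set G) :
  finite_set F -> (forall k, H_finite H (D k)) ->
  H_finite H (\bigcup_(k in F) D k).
Proof.
move=> finF finD.
have /choice[E EP] : forall k, exists E, finite_set E /\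
    D k `<=` \bigcup_(l in E) [set h * l | h in H].
  by move=> k; have [E finE DE] := finD k; exists E.
exists (\bigcup_(k in F) E k).
  by apply: bigcup_finite => // k _; case: (EP k).
move=> a [k Fk /(proj2 (EP k))[l El Hl]].
by exists l => //; exists k.
Qed.

Lemma H_finiteU H X Y : H_finite H X -> H_finite H Y -> H_finite H (X `|` Y).
Proof.
move=> [E finE XE] [F finF YF]; exists (E `|` F); first by rewrite finite_setU.
by rewrite bigcup_setU; exact: setUSS.
Qed.

Lemma H_finite_ltranslate A g Y :
  H_finite (Stab A) Y -> H_finite (Stab (ltranslate g A)) (ltranslate g Y).
Proof.
move=> [F finF YF]; exists [set g * k | k in F]; first exact: finite_image.
move=> _ [y /YF[k Fk [h hA <-]] <-]; exists (g * k); first by exists k.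
exists (g * h * g^-1); first exact: Stab_ltranslate.
by rewrite mulgA mulgVK mulgA.
Qed.

Lemma H_finite_ltranslateK A g Y :
  H_finite (Stab (ltranslate g A)) (ltranslate g Y) -> H_finite (Stab A) Y.
Proof.
move=> /(H_finite_ltranslate _ g^-1).
by rewrite !ltranslateM mulVg !ltranslate1.
Qed.

(** The first two clauses express nontriviality. The set in the third is the symmetric difference of
    [A] and its right translate by [g^-1]. *)
Definition almost_invariant A : Prop :=
  [/\ ~ H_finite (Stab A) A, ~ H_finite (Stab A) (~` A) &
      forall g, H_finite (Stab A) [set a | ~ (A a <-> A (a * g))]].

Lemma almost_invariantC A : almost_invariant A -> almost_invariant (~` A).
Proof.
move=> [nA nCA ai]; split; rewrite Stab_setC ?setCK // => g.
by apply: H_finite_sub (ai g) => a /= naC aP; apply: naC; rewrite aP.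
Qed.

Lemma almost_invariant_ltranslate A g :
  almost_invariant A -> almost_invariant (ltranslate g A).
Proof.
move=> [nA nCA ai]; split=> [|| h].
- by move=> /H_finite_ltranslateK.
- by rewrite -ltranslateC => /H_finite_ltranslateK.
- apply: H_finite_sub (H_finite_ltranslate A g _ (ai h)) => a /=.
  by rewrite !ltranslateE mulgA.
Qed.

Lemma almost_invariant_Sigma A X :
  almost_invariant X -> Sigma_of X A -> almost_invariant A.
Proof.
move=> aiX [g [->|->]]; apply: almost_invariant_ltranslate => //.
exact: almost_invariantC.
Qed.

(** If the [Stab A]-coset of every point of [Y] met [D], the finitely many cosets covering [D] would
    cover [Y] as well. *)
Lemma coset_avoiding A D Y :
  H_finite (Stab A) D -> ~ H_finite (Stab A) Y ->
  exists2 l, Y l & forall h, Stab A h -> ~ D (h * l).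
Proof.
move=> [F finF DF] nY; apply: contrapT => none; apply: nY; exists F => // l Yl.
have [h hA Dhl] : exists2 h, Stab A h & D (h * l).
  apply: contrapT => noh; apply: none; exists l => // h hA Dhl.
  by apply: noh; exists h.
have [k Fk [h' h'A hk]] := DF _ Dhl; exists k => //.
exists (h^-1 * h'); first exact: StabM (StabV _ _ hA) h'A.
by rewrite -mulgA hk mulKg.
Qed.

Lemma H_finite_transfer A B D Y :
  almost_invariant B -> ~ H_finite (Stab A) Y ->
  (forall h a, Stab A h -> Y a -> Y (h * a)) ->
  H_finite (Stab A) (Y `&` B) -> D `<=` B -> H_finite (Stab A) D ->
  H_finite (Stab B) D.
Proof.
move=> [_ _ aiB] nY AY YB DB [F finF DF].
have [l Yl hl] := coset_avoiding _ _ _ YB nY.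
apply: H_finite_sub (H_finite_bigcup _ _ _ finF (fun k => aiB (k^-1 * l))).
move=> d Dd; have [k Fk [h hA hkd]] := DF d Dd; exists k => //= dP.
apply: (hl h hA); split; first exact: AY.
by move/dP: (DB d Dd); rewrite -hkd -mulgA mulVKg.
Qed.

(** The transfer applies with [Y] equal to [A], which is a union of [Stab A]-cosets and is not
    small. *)
Lemma small_sym A B : almost_invariant A -> almost_invariant B ->
  H_finite (Stab A) (A `&` B) -> H_finite (Stab B) (A `&` B).
Proof.
move=> [nA _ _] aiB AB; apply: (H_finite_transfer A B _ A) => //.
by move=> h a hA /(Stab_mem _ _ _ hA).
Qed.

Lemma small_symE A B : almost_invariant A -> almost_invariant B ->
  H_finite (Stab A) (A `&` B) <-> H_finite (Stab B) (A `&` B).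
Proof.
move=> aiA aiB; split; first exact: small_sym.
by rewrite setIC; exact: small_sym.
Qed.

Lemma corner_small_sym A B C : almost_invariant A -> almost_invariant B ->
  corners A B C -> H_finite (Stab A) C <-> H_finite (Stab B) C.
Proof.
move=> aiA aiB; have aiCA := almost_invariantC _ aiA.
have aiCB := almost_invariantC _ aiB.
case=> ->; have := @small_symE.
- by apply.
- by rewrite -(Stab_setC B); apply.
- by rewrite -(Stab_setC A); apply.
- by rewrite -(Stab_setC A) -(Stab_setC B); apply.
Qed.

(** The set [B] cuts the corner in two. The part outside [B] is small by assumption; the part inside
    is small modulo [Stab B], and the transfer with [Y] the complement of [B] brings it to
    [Stab A]. *)
Lemma small_trans A B C :
  almost_invariant A -> almost_invariant B -> almost_invariant C ->
  H_finite (Stab A) (A `&` ~` B) -> H_finite (Stab B) (B `&` ~` C) ->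
  H_finite (Stab A) (A `&` ~` C).
Proof.
move=> aiA aiB aiC AB BC; have [_ nCB _] := aiB.
have BA : H_finite (Stab B) (~` B `&` A).
  rewrite setIC -(Stab_setC B).
  by apply: small_sym => //; exact: almost_invariantC.
have ABC : H_finite (Stab A) (A `&` B `&` ~` C).
  apply: (H_finite_transfer B A _ (~` B)) => // [h a hB nBa|a [[]] //|].
    by move/(Stab_mem _ _ _ hB).
  by apply: H_finite_sub BC => a [[]].
apply: H_finite_sub (H_finiteU _ _ _ AB ABC) => a [Aa nCa].
by have [Ba|nBa] := pselect (B a); [right | left].
Qed.

(** * The order axioms for [ai_le] *)

Lemma ai_le_small A B : ai_le A B -> H_finite (Stab A) (A `&` ~` B).
Proof. by case=> [->|[[]] //]; exact: H_finite0. Qed.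

(* The only small corner cannot be nonempty when the opposite one is small. *)
Lemma ai_le_empty A B :
  ai_le A B -> H_finite (Stab A) (~` A `&` B) -> A `&` ~` B = set0.
Proof.
case=> // -[_ only] sBA; rewrite -(setIid (A `&` ~` B)).
rewrite -{1}(only (~` A `&` B)).
  by apply/seteqP; split=> // a [[]] + _ [].
by split=> //; constructor 3.
Qed.

Lemma ai_le_refl A : ai_le A A.
Proof. by left; rewrite setICr. Qed.

Lemma ai_le_antisym A B :
  almost_invariant A -> almost_invariant B -> ai_le A B -> ai_le B A -> A = B.
Proof.
have sub X Y : almost_invariant X -> almost_invariant Y ->
    ai_le X Y -> ai_le Y X -> X `<=` Y.
  move=> aiX aiY XY /ai_le_small sYX; rewrite -[Y]setCK.
  apply/disjoints_subset/ai_le_empty => //; rewrite setIC.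
  by apply/(corner_small_sym X Y) => //; constructor 3; rewrite setIC.
by move=> aiA aiB AB BA; apply/seteqP; split; exact: sub.
Qed.

Lemma ai_le_trans A B C :
  almost_invariant A -> almost_invariant B -> almost_invariant C ->
  ai_le A B -> ai_le B C -> ai_le A C.
Proof.
move=> aiA aiB aiC AB BC; have [[nA _ _] [_ nCC _]] := (aiA, aiC).
have sAB := ai_le_small _ _ AB; have sBC := ai_le_small _ _ BC.
have sAC := small_trans _ _ _ aiA aiB aiC sAB sBC.
have flip X Y : almost_invariant X -> almost_invariant Y ->
    H_finite (Stab X) (X `&` ~` Y) <-> H_finite (Stab Y) (~` Y `&` X).
  move=> aiX aiY; rewrite setIC.
  by apply: corner_small_sym => //; constructor 2; rewrite setIC.
have [sCA|nsCA] := pselect (H_finite (Stab A) (~` A `&` C)).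
  (* Going round the cycle from [A] to [B] to [C] and back makes both reverse corners small, so
     [ai_le_empty] turns the two relations into inclusions. *)
  move: sCA => /(flip _ _ aiC aiA) sCA.
  have /(flip _ _ aiB aiA) sBA := small_trans _ _ _ aiB aiC aiA sBC sCA.
  have /(flip _ _ aiC aiB) sCB := small_trans _ _ _ aiC aiA aiB sCA sAB.
  have /disjoints_subset := ai_le_empty _ _ AB sBA.
  have /disjoints_subset := ai_le_empty _ _ BC sCB.
  rewrite !setCK => subBC subAB; left; apply/disjoints_subset; rewrite setCK.
  exact: subset_trans subBC.
(* The opposite corner is now known not to be small. A small adjacent corner would, together with
   the small corner, cover [A] or the complement of [C]. *)
right; split=> [|D [[] -> // sD]]; first by split=> //; constructor 2.
- case: nA; apply: H_finite_sub (H_finiteU _ _ _ sD sAC) => a Aa.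
  by have [Ca|nCa] := pselect (C a); [left | right].
- case: nCC.
  have sCC : H_finite (Stab C) (A `&` ~` C `|` ~` A `&` ~` C).
    apply: H_finiteU; apply/(corner_small_sym A C) => //.
      by constructor 2.
    by constructor 4.
  apply: H_finite_sub sCC => a nCa.
  by have [Aa|nAa] := pselect (A a); [left | right].
Qed.

End AlmostInvariantSets.

Arguments almost_invariant {G} A.

(** * Sets arising from a splitting are almost invariant *)

Section TreeSets.
Variables (G : groupType) (S : splitting G).
Local Open Scope group_scope.
Implicit Types (g k : G) (v x y : vertex S).

Let pointing v x y : set G := [set g | points_away x y (act S g v)].

Lemma pointing_setC v x y :
  adj S x y -> ~` pointing v x y = pointing v y x.
Proof.
by move=> xy; apply/seteqP; split=> g /(points_awayC _ _ _ _ _ xy).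
Qed.

(** The orbit of [v] need not contain [a] itself, but it meets the edge [{a, c}], both of whose ends
    lie in the deep half-tree. *)
Lemma pointing_deep v x y n : adj S x y ->
  exists2 g, pointing v x y g &
    forall p, path (adj S) (act S g v) p ->
      ~ points_away x y (last (act S g v) p) -> n <= size p.
Proof.
move=> xy; have oneq := splitting_one_edge S.
have noleaf := no_leaf _ _ oneq (splitting_no_fixed_point (s := S)).
have tS := gtree_is_tree S.
have [a [b [ab abxy deep]]] := half_deep _ _ tS x y n noleaf xy.
have [c ac cb] := noleaf a b ab.
have [g gv] := adj_meets_orbit _ _ v _ _ oneq ac.
have abg : points_away a b (act S g v).
  case: gv => ->; first exact: joined_refl.
  by apply: (half_nested _ _ tS a b c c ab ac cb); exact: joined_refl.
by exists g => [|p]; [exact: abxy | exact: deep].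
Qed.

(** Let [N] exceed the lengths of chosen walks from the [k v], with [k] in [F], to one [g' v]
    outside the half-tree. For [g = h k], translating such a walk by [h] leads from [g v] out of the
    half-tree, as [h] stabilises [X]. This contradicts the choice of [g] at depth [N]. *)
Lemma pointing_not_small v x y : adj S x y ->
  ~ H_finite (Stab (pointing v x y)) (pointing v x y).
Proof.
set X := pointing v x y => xy [F finF XF].
have yx : adj S y x by rewrite (tree_sym (gtree_is_tree S)).
(* Depth 0 suffices: only a point in the opposite half-tree is wanted. *)
have [g' yg' _] := pointing_deep v _ _ 0 yx.
have nXg' : ~ X g' by apply/(points_awayC _ _ _ _ _ xy).
have [N NP] : exists N, forall k, F k -> exists p,
    [/\ path (adj S) (act S k v) p, last (act S k v) p = act S g' v
      & size p < N].
  have /finite_seqP[s ->] := finF; elim: s => [|k s [N NP]]; first by exists 0.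
  have [p kp pE] := tree_connected (gtree_is_tree S) (act S k v) (act S g' v).
  exists (maxn (size p).+1 N) => l /=; rewrite inE.
  case/orP=> [/eqP->|/NP[q [lq qE ltq]]].
    by exists p; rewrite leq_maxl.
  by exists q; rewrite leq_max ltq orbT.
have [g Xg deep] := pointing_deep v _ _ N xy.
have [k Fk [h hX hkg]] := XF g Xg; have [p [kp pE ltpN]] := NP k Fk.
have := deep (map (act S h) p).
rewrite -hkg gtree_actM path_act last_map pE size_map leqNgt ltpN => /(_ kp) H.
suff: false by [].
apply: H => hg'; apply: nXg'; apply/(Stab_mem _ _ _ _ hX).
by rewrite /X /pointing /= gtree_actM.
Qed.

Lemma points_away_act g x y w :
  points_away x y w -> points_away (act S g x) (act S g y) (act S g w).
Proof.
pose away w' := points_away (act S g x) (act S g y) (act S g w').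
apply: (joined_ind _ _ away x) => [|u z _ gu].
  exact: joined_refl.
move=> /and3P[uz nxy nyx]; apply: joined_rcons gu _.
have inj := can_inj (actK _ S g).
rewrite /remove_edge gtree_act_adj uz !xpair_eqE !(inj_eq inj).
by rewrite -!xpair_eqE nxy.
Qed.

(** This lets finiteness modulo the edge stabiliser pass to finiteness modulo the stabiliser of the
    set. *)
Lemma edge_stab_sub v x y : edge_stab x y `<=` Stab (pointing v x y).
Proof.
have sub h : edge_stab x y h ->
    pointing v x y `<=` ltranslate h (pointing v x y).
  move=> [hx hy] g xg; apply/ltranslateE; rewrite /pointing /= gtree_actM.
  by rewrite -(actK _ S h x) -(actK _ S h y) hx hy; exact: points_away_act.
move=> h hE; apply/seteqP; split; last exact: sub.
have hVE : edge_stab x y h^-1.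
  by case: hE => hx hy; split; [rewrite -{1}hx actK | rewrite -{1}hy actK].
move=> g /ltranslateE /(sub _ hVE) /ltranslateE.
by rewrite invgK mulVKg.
Qed.

(** The fibre is empty or a single right coset of the edge stabiliser. *)
Lemma edge_fibre_small x y u w :
  H_finite (edge_stab x y) [set a | act S a u = x /\ act S a w = y].
Proof.
have [[a0 [a0u a0w]]|none] :=
  pselect (exists a, act S a u = x /\ act S a w = y); last first.
  by apply: H_finite_sub (H_finite0 _ _) => a aE; apply: none; exists a.
exists [set a0]; first exact: finite_set1.
move=> a [au aw]; exists a0 => //; exists (a * a0^-1); last by rewrite mulgVK.
by split; rewrite gtree_actM; [rewrite -{1}a0u actK | rewrite -{1}a0w actK].
Qed.

(* A translate by [a] of the walk from [v] to [g v] that leaves the half-tree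
   runs through [{x, y}], i.e. [a] maps an edge of the walk to that edge. *)
Lemma pointing_right_translate v x y g :
  H_finite (Stab (pointing v x y))
    [set a | ~ (pointing v x y a <-> pointing v x y (a * g))].
Proof.
set X := pointing v x y.
have finH D : H_finite (edge_stab x y) D -> H_finite (Stab X) D.
  move=> [F finF DF]; exists F => // a /DF[k Fk [h hE <-]].
  by exists k => //; exists h => //; exact: edge_stab_sub.
have tS := gtree_is_tree S.
have [p vp pE] := tree_connected tS v (act S g v).
have eqX a : X (a * g) = points_away x y (act S a (act S g v)).
  by rewrite /X /pointing /= gtree_actM.
suff gen u : path (adj S) u p -> H_finite (Stab X)
    [set a | ~ (points_away x y (act S a u)
                <-> points_away x y (act S a (last u p)))].
  by apply: H_finite_sub (gen v vp) => a /=; rewrite eqX pE.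
elim: p {vp pE} u => [|w p IHp] u /=.
  by move=> _; apply: H_finite_sub (H_finite0 _ _) => a /=; apply.
case/andP=> uw /IHp wp.
have fib := H_finiteU _ _ _ _ (finH _ (edge_fibre_small x y u w))
                              (finH _ (edge_fibre_small x y w u)).
apply: H_finite_sub (H_finiteU _ _ _ _ fib wp) => a /= neq.
have auw : adj S (act S a u) (act S a w) by rewrite gtree_act_adj.
have awu : adj S (act S a w) (act S a u) by rewrite (tree_sym tS).
apply: contrapT => nfib; apply: neq.
have -> : points_away x y (act S a u) <-> points_away x y (act S a w).
  split=> [/(half_step _ _ _ _ _ _ auw)|/(half_step _ _ _ _ _ _ awu)].
    by case=> [//|[? ?]]; case: nfib; left; left.
  by case=> [//|[? ?]]; case: nfib; left; right.
by apply: contrapT => nwp; apply: nfib; right.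
Qed.

Lemma arises_from_almost_invariant (H X : set G) :
  arises_from S H X -> almost_invariant X.
Proof.
move=> [v [x [y [xy _ ->]]]]; split.
- exact: pointing_not_small.
- rewrite -Stab_setC pointing_setC //; apply: pointing_not_small.
  by rewrite (tree_sym (gtree_is_tree S)).
- by move=> g; exact: pointing_right_translate.
Qed.

End TreeSets.

Theorem corollary6p5 (G : groupType) (J : Type) (sigma : J -> splitting G)
    (Hnoniso : forall i j : J, i <> j -> ~ splitting_iso (sigma i) (sigma j))
    (H X : J -> set G)
    (HX : forall j : J, arises_from (sigma j) (H j) (X j)) :
  let Sigma : set (set G) := \bigcup_(j in [set: J]) Sigma_of (X j) in
  (forall A B C : set G, Sigma A -> Sigma B -> corners A B C ->
     H_finite (Stab A) C <-> H_finite (Stab B) C) /\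
  Relation_Definitions.order (set_type Sigma)
    (fun A B => ai_le (val A) (val B)).
Proof.
move=> Sigma.
(* Members of [Sigma] are translates of some [X j] or of its complement, so the general facts on
   almost invariant sets apply to them. *)
have ai A : Sigma A -> almost_invariant A.
  move=> [j _]; apply: almost_invariant_Sigma.
  exact: arises_from_almost_invariant (HX j).
have aiv (A : set_type Sigma) : almost_invariant (val A).
  by apply: ai; exact: set_valP.
split=> [A B C /ai aiA /ai aiB|]; first exact: corner_small_sym.
split=> [A|A B C|A B AB BA]; first exact: ai_le_refl.
- exact: ai_le_trans.
- by apply: val_inj; exact: ai_le_antisym.
Qed.
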